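(* Let $\mathcal{H}$ be a real Hilbert space, let $\lambda>0$, $\mu=\frac1\lambda$, and let $\Phi:\mathcal{H}\to\mathbb{R}^+$ be a convex differentiable function whose gradient is $L$-Lipschitz continuous for some $L>0$, with $C=\mathrm{argmin}\,\Phi=\Phi^{-1}(0)\neq\emptyset$, and assume $\mu L<1$. Let $\varepsilon:[0,+\infty[\to[0,+\infty[$ satisfy: (H1) for every $p\in R(N_C)$, $\displaystyle\int_0^{+\infty}\Big(\mu\Phi^*\big(\tfrac{1}{\mu}\varepsilon(t)p\big)-\sigma_C(\varepsilon(t)p)+\tfrac12\|\varepsilon(t)p\|^2\Big)dt<+\infty$; (H2) $\varepsilon(\cdot)$ is nonincreasing, of class $C^1$, Lipschitz continuous on $[0,+\infty[$, $\lim_{t\to+\infty}\varepsilon(t)=0$, $\int_0^{+\infty}\varepsilon(t)dt=+\infty$, and for some $k\ge0$, $-k\varepsilon^2\le\dot\varepsilon$. Let $(x(\cdot),\upsilon(\cdot))$ be a strong global solution of $$\upsilon(t)=\nabla\Phi(x(t)),\qquad \lambda\dot x(t)+\dot\upsilon(t)+\upsilon(t)+\varepsilon(t)x(t)=0,$$ and set $y(t)=x(t)+\mu\upsilon(t)$. Then $x(t)$ and $y(t)$ converge strongly, as $t\to+\infty$, to the element of minimal norm of $C$.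
   Context: $\Phi^*$ is the Fenchel conjugate of $\Phi$; $\sigma_C(x^* )=\sup_{c\in C}\langle x^*,c\rangle$; $N_C(x)=\{x^*:\langle x^*,c-x\rangle\le0\ \forall c\in C\}$ for $x\in C$ and $R(N_C)=\bigcup_{x\in C}N_C(x)$. A strong global solution means $x,\upsilon$ absolutely continuous on every bounded interval, the inclusion holding for all $t\ge0$ and the differential equation for almost every $t\ge0$. *)

(* Defs.v *)
From HB Require Import structures.
From mathcomp Require Import all_boot all_order all_algebra.
From mathcomp Require Import all_classical all_reals all_analysis.
Set Implicit Arguments. Unset Strict Implicit. Unset Printing Implicit Defensive.
Import Order.TTheory GRing.Theory Num.Theory.
Import numFieldNormedType.Exports.
Local Open Scope classical_set_scope.
Local Open Scope ring_scope.

(* [ip] is an inner product on the normed space V inducing its norm.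
   Together with completeness of V this makes V a real Hilbert space. *)
Definition is_inner_product (R : realType) (V : normedModType R)
  (ip : V -> V -> R) : Prop :=
  (forall x y, ip x y = ip y x) /\
  (forall (a : R) (x y z : V), ip (a *: x + y) z = a * ip x z + ip y z) /\
  (forall x, ip x x = `|x| ^+ 2).

Definition convex_fun (R : realType) (V : normedModType R) (f : V -> R) : Prop :=
  forall (x y : V) (t : R), 0 <= t -> t <= 1 ->
    f ((1 - t) *: x + t *: y) <= (1 - t) * f x + t * f y.

Definition fenchel (R : realType) (V : normedModType R) (ip : V -> V -> R)
  (f : V -> R) (y : V) : \bar R :=
  ereal_sup [set (ip y x - f x)%:E | x in [set: V]].

Definition support_fun (R : realType) (V : normedModType R) (ip : V -> V -> R)
  (C : set V) (y : V) : \bar R :=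
  ereal_sup [set (ip y c)%:E | c in C].

Definition normal_cone (R : realType) (V : normedModType R) (ip : V -> V -> R)
  (C : set V) (x : V) : set V :=
  [set p | forall c, C c -> ip p (c - x) <= 0].

Definition range_normal_cone (R : realType) (V : normedModType R)
  (ip : V -> V -> R) (C : set V) : set V :=
  [set p | exists2 x, C x & normal_cone ip C x p].

Definition abs_cont_on (R : realType) (V : normedModType R) (f : R -> V)
  (a b : R) : Prop :=
  forall e : R, 0 < e -> exists2 d : R, 0 < d &
    forall (n : nat) (a_ b_ : nat -> R),
      (forall i, (i < n)%N -> a <= a_ i /\ a_ i <= b_ i /\ b_ i <= b) ->
      (forall i j, (i < n)%N -> (j < n)%N -> i <> j ->
          b_ i <= a_ j \/ b_ j <= a_ i) ->
      \sum_(i < n) (b_ i - a_ i) < d ->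
      \sum_(i < n) `|f (b_ i) - f (a_ i)| < e.

(* Main.v *)
(* With y = x + mu v the system reads y' = - mu (v + eps x) for almost every t.
   Let p be the zero of Phi of minimal norm and theta = |y - p|^2 / 2. The
   gradient inequality and the viscosity bound
     2 Phi z + e |z|^2 >= e (|p|^2 - eta)   for all z and all small e >= 0
   give theta' <= - c eps (theta - O(eta)) almost everywhere for large t; the
   remaining cross term mu eps <x, v> is absorbed in mu |v|^2 at a cost of order
   eps^2. As the integral of eps diverges, theta tends to 0, and
   |x - p| <= |y - p| by monotonicity of the gradient.
   Integrating the differential inequality only takes that an absolutely
   continuous function whose derivative is almost everywhere nonpositive is
   nonincreasing. *)
Require Import Defs.
From HB Require Import structures.
From mathcomp Require Import all_boot all_order all_algebra.
From mathcomp Require Import all_classical all_reals all_analysis.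
From mathcomp Require Import ring lra.
Import Order.TTheory GRing.Theory Num.Theory.
Import numFieldNormedType.Exports.
Local Open Scope classical_set_scope.
Local Open Scope ring_scope.

Set Implicit Arguments.
Unset Strict Implicit.

(** * Monotonicity from the sign of the derivative almost everywhere *)

Section AbsoluteContinuity.
Variable (R : realType).
Notation mu := (@lebesgue_measure R).

(** Continuous induction: at the supremum of the points reached, the local hypothesis moves [P] from
    a point at most [d] before it either to [b] or to a point beyond it, which is absurd. *)
Lemma sup_induction (P : R -> Prop) (a b : R) : a <= b -> P a ->
  (forall r, a <= r <= b -> exists2 d, 0 < d &
    forall t s, a <= t -> r - d <= t -> t <= r -> r <= s -> s <= r + d ->
      s <= b -> P t -> P s) ->
  P b.
Proof.
move=> ab Pa loc.
pose S := [set t | a <= t <= b /\ P t].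
have Sa : S a by split=> //; rewrite lexx.
have supS : has_sup S.
  by split; [exists a|exists b => t [/andP[]]].
have arb : a <= sup S <= b.
  apply/andP; split; first by apply: ub_le_sup => //; case: supS.
  by apply: ge_sup; [exists a|move=> t [/andP[]]].
have [d d0 locd] := loc _ arb.
have [t [/andP[at_ tb] Pt] tS] := sup_adherent d0 supS.
have tS' : t <= sup S.
  by apply: ub_le_sup; [case: supS|split=> //; rewrite at_].
case/andP: arb => aS Sb.
have [bS|Sb'] := leP b (sup S + d).
  by apply: (locd t b) => //; exact: ltW.
suff : sup S + d <= sup S by rewrite gerDl leNgt d0.
apply: ub_le_sup; first by case: supS.
split; first by rewrite (ltW Sb') andbT (le_trans aS)// lerDl ltW.
by apply: (locd t (sup S + d)); rewrite ?lerDl// ltW.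
Qed.

(* Some finite family of disjoint intervals of [a, t], of total length at most
   the measure of U in ]a, t], has an oscillation sum of g that accounts for the
   increase of g on [a, t], up to slope e. *)
Definition covered_chain (g : R -> R) (U : set R) (a e t : R) :=
  exists n (a_ b_ : nat -> R),
  [/\ forall i, (i < n)%N -> [/\ a <= a_ i, a_ i <= b_ i & b_ i <= t],
      forall i j, (i < n)%N -> (j < n)%N -> i <> j ->
          b_ i <= a_ j \/ b_ j <= a_ i,
      ((\sum_(i < n) (b_ i - a_ i))%:E <= mu (U `&` `]a, t]%classic))%E &
      g t - g a <= e * (t - a) + \sum_(i < n) `|g (b_ i) - g (a_ i)|].

(** The family is unchanged: the step from [t] to [s] is charged to the slope term. *)
Lemma covered_chain_slope g U a e t s : open U -> t <= s ->
  g s - g t <= e * (s - t) -> covered_chain g U a e t ->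
  covered_chain g U a e s.
Proof.
move=> oU ts gts [n [a_ [b_ [ab disj len gt]]]]; exists n, a_, b_; split=> //.
- by move=> i /ab[? ? bt]; split=> //; exact: le_trans ts.
- apply: (le_trans len); apply: le_measure; rewrite ?inE.
  + by apply: measurableI => //; exact: measurable_realfun.open_measurable.
  + by apply: measurableI => //; exact: measurable_realfun.open_measurable.
  + apply: setIS; exact: subset_itvl.
- by move: (\sum_(i < n) _) gt => X gt; lra.
Qed.

(** The interval from [t] to [s] joins the family; as it lies in [U], the measure on the right grows
    by exactly its length. *)
Lemma covered_chain_cover g U a e t s : open U -> 0 <= e -> a <= t -> t <= s ->
  `]t, s] `<=` U -> covered_chain g U a e t ->
  covered_chain g U a e s.
Proof.
move=> oU e0 at_ ts tsU [n [a_ [b_ [ab disj len gt]]]].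
have mU := measurable_realfun.open_measurable oU.
exists n.+1, (fun i => if (i < n)%N then a_ i else t),
  (fun i => if (i < n)%N then b_ i else s).
have eqsum (F G : nat -> R) (h : R -> R -> R) :
    \sum_(i < n.+1) h (if (i < n)%N then F i else s) (if (i < n)%N then G i else t)
    = \sum_(i < n) h (F i) (G i) + h s t.
  rewrite big_ord_recr/= ltnn; congr (_ + _).
  by apply: eq_bigr => i _; rewrite ltn_ord.
split.
- move=> i _; case: ifPn => [/ab[? ? bt]|_]; last by split.
  by split=> //; exact: le_trans ts.
- move=> i j; rewrite !ltnS => in_ jn ij.
  case: ifPn => i1; case: ifPn => j1; first exact: disj.
  + by left; have [] := ab _ i1.
  + by right; have [] := ab _ j1.
  (* Two indices outside the old range both equal [n]. *)
  + exfalso; apply: ij; apply/eqP; rewrite eqn_leq.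
    rewrite -leqNgt in i1; rewrite -leqNgt in j1.
    by rewrite (leq_trans in_ j1) (leq_trans jn i1).
- rewrite (eqsum b_ a_ (fun u v => u - v)) EFinD.
  rewrite (_ : U `&` `]a, s] = (U `&` `]a, t]) `|` `]t, s]); last first.
    apply/seteqP; split=> [r [Ur]|r [[Ur]|/[dup] rts]] /=; rewrite !in_itv/=.
    + move=> /andP[ar rs]; have [rt|rt] := leP r t; first by left; rewrite ar.
      by right.
    + by move=> /andP[-> rt]; split=> //; exact: le_trans ts.
    + move=> /andP[tr ->]; split; first exact: tsU.
      by rewrite (le_lt_trans at_).
  rewrite measureU//; first last.
  + apply/seteqP; split=> // r [[_]] /=; rewrite !in_itv/=.
    by move=> /andP[_ rt] /andP[/lt_le_trans/(_ rt)]; rewrite ltxx.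
  + exact: measurableI.
  have <- : mu `]t, s]%classic = (s - t)%:E.
    rewrite lebesgue_measure_itv/= lte_fin.
    case: ltP => [|st]; rewrite ?EFinB//.
    by rewrite (@le_anti _ _ t s) ?ts ?st// subee.
  exact: leeD.
- rewrite (eqsum b_ a_ (fun u v => `|g u - g v|)).
  have := ler_norm (g s - g t); have : 0 <= e * (s - t) by rewrite mulr_ge0// subr_ge0.
  by move: (\sum_(i < n) _) gt => X gt; lra.
Qed.

(* Every point of [a, b] either has small difference quotients or lies in an
   open set of small measure, on which absolute continuity bounds the variation. *)
Lemma abs_cont_ae_derive_le0 (g : R -> R) (a b : R) : a <= b ->
  abs_cont_on g a b ->
  {ae mu, forall t, a <= t <= b -> derivable g t 1 /\ derive1 g t <= 0} ->
  g b <= g a.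
Proof.
move=> ab ACg [N [mN N0 subN]].
apply/ler_addgt0Pr => e' e'0.
(* Chosen so that [e * (b - a) + e = e']: one share for the slopes, one for the oscillation. *)
pose e := e' / (b - a + 1).
have ba1 : 0 < b - a + 1 by rewrite ltr_wpDl// subr_ge0.
have e0 : 0 < e by rewrite divr_gt0.
have [d d0 ACd] := ACg e e0.
(* The exceptional set is null, so outer regularity encloses it in an open set smaller than the [d]
   of absolute continuity. *)
have [|U [oU NU Ud]] := @lebesgue_regularity_outer R N d mN _ d0.
  by rewrite [X in (X < _)%E](_ : _ = 0%E)// ltry.
have mU := measurable_realfun.open_measurable oU.
have muU : (mu U < d%:E)%E.
  rewrite -(setDUK NU) measureU//; last 2 first.
  - exact: measurableD.
  - by rewrite setIDA setIC -setIDA setDv setI0.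
  by rewrite [X in (X + _)%E](_ : _ = 0%E)// add0e.
have : covered_chain g U a e b.
  apply: (@sup_induction _ a) => //.
    exists 0%N, (fun=> 0), (fun=> 0); split=> //; first by rewrite big_ord0.
    by rewrite big_ord0 !subrr mulr0 addr0.
  move=> r /andP[ar rb].
  have [Ur|nUr] := pselect (U r).
    have [d' d'0 rU] : exists2 d', 0 < d' & forall s, `|r - s| < d' -> U s.
      have /nbhs_ballP[d' /= d'0 rU] : nbhs r U by exact: open_nbhs_nbhs.
      by exists d' => // s rs; apply: rU.
    exists (d' / 2); first by rewrite divr_gt0.
    move=> t s at_ rt tr rs srd sb; apply: covered_chain_cover => //.
    - exact: ltW.
    - exact: le_trans rs.
    - move=> w /=; rewrite in_itv/= => /andP[tw ws]; apply: rU.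
      rewrite ltr_norml; apply/andP; split; lra.
  have [dg g'] : derivable g r 1 /\ derive1 g r <= 0.
    apply: contrapT => h; apply: nUr; apply: NU; apply: subN => /= h'.
    by apply: h; apply: h'; rewrite ar rb.
  have [d' d'0 slope] : exists2 d', 0 < d' & forall h, `|h| <= d' -> h != 0 ->
      h^-1 * (g (r + h) - g r) <= e.
    have /cvgrPdist_lt/(_ _ e0) : h^-1 *: ((g \o shift r) (h *: 1) - g r)
        @[h --> 0^'] --> derive1 g r by rewrite derive1E; exact: dg.
    case=> d' /= d'0 H; exists (d' / 2); first by rewrite divr_gt0.
    move=> h hd h0.
    have := H h; rewrite /ball_/= sub0r normrN => /(_ _ h0).
    rewrite [h *: 1]mulr1 [h + r]addrC => H'.
    have : `|derive1 g r - h^-1 *: (g (r + h) - g r)| < e.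
      by apply: H'; lra.
    rewrite ltr_norml => /andP[+ _]; rewrite -[_ *: _]/(_ * _); lra.
  exists d' => // t s at_ rt tr rs srd sb Ct.
  (* Only quotients based at [r] are controlled, so the chain goes from [t] to [r] and then from [r]
     to [s]; the second step is treated first. *)
  apply: (@covered_chain_slope _ _ _ _ r) => //.
    have [->|sr] := eqVneq s r; first by rewrite !subrr mulr0.
    have sr0 : 0 < s - r by rewrite subr_gt0 lt_neqAle eq_sym sr.
    have : (s - r)^-1 * (g s - g r) <= e.
      have := slope (s - r); rewrite subrKC; apply; last by rewrite gt_eqF.
      by rewrite gtr0_norm//; lra.
    by rewrite ler_pdivrMl// mulrC.
  apply: (@covered_chain_slope _ _ _ _ t) => //.
  have [->|rt'] := eqVneq r t; first by rewrite !subrr mulr0.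
  have rt0 : t - r < 0 by rewrite subr_lt0 lt_neqAle eq_sym rt'.
  have : (t - r)^-1 * (g t - g r) <= e.
    have := slope (t - r); rewrite subrKC; apply; last by rewrite lt_eqF.
    by rewrite ltr0_norm//; lra.
  by rewrite ler_ndivrMl//; lra.
move=> [n [a_ [b_ [ab_ disj len gba]]]].
have len' : \sum_(i < n) (b_ i - a_ i) < d.
  rewrite -lte_fin (le_lt_trans len)// (le_lt_trans _ muU)// le_measure ?inE//.
  exact: measurableI.
have : \sum_(i < n) `|g (b_ i) - g (a_ i)| < e.
  by apply: ACd => // i /ab_[].
have : e' = e * (b - a) + e by rewrite /e; field; rewrite gt_eqF.
by move: (\sum_(i < n) _) gba => X gba; lra.
Qed.

(** * Stability properties of absolute continuity *)

Lemma abs_cont_onS (V : normedModType R) (f : R -> V) (a a' b : R) :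
  a <= a' -> abs_cont_on f a b -> abs_cont_on f a' b.
Proof.
move=> aa' ACf e e0; have [d d0 H] := ACf e e0; exists d => // n a_ b_ ab.
by apply: H => i /ab[a'a]; split=> //; exact: le_trans a'a.
Qed.

Lemma abs_cont_on_dominated (U V W : normedModType R) (f : R -> U) (g : R -> V)
    (h : R -> W) (a b M : R) :
  abs_cont_on f a b -> abs_cont_on g a b ->
  (forall s t, a <= s -> s <= t -> t <= b ->
    `|h t - h s| <= M * (`|f t - f s| + `|g t - g s|)) ->
  abs_cont_on h a b.
Proof.
move=> ACf ACg hM e e0.
(* [|M| + 1] is positive whatever the sign of [M]; the factor 2 splits [e] between [f] and [g]. *)
pose e' := e / (2 * (`|M| + 1)).
have M1 : 0 < `|M| + 1 by rewrite ltr_wpDl.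
have e'0 : 0 < e' by rewrite divr_gt0// mulr_gt0.
have [d1 d10 H1] := ACf e' e'0; have [d2 d20 H2] := ACg e' e'0.
exists (Num.min d1 d2); first by rewrite lt_min d10.
move=> n a_ b_ ab disj; rewrite lt_min.
move=> /andP[/(H1 n a_ b_ ab disj) f1 /(H2 n a_ b_ ab disj) g2].
apply: (@le_lt_trans _ _ ((`|M| + 1) *
  (\sum_(i < n) `|f (b_ i) - f (a_ i)| + \sum_(i < n) `|g (b_ i) - g (a_ i)|))).
  rewrite -big_split mulr_sumr; apply: ler_sum => i _.
  have [ai [aibi bi]] := ab i (ltn_ord i).
  apply: (le_trans (hM _ _ ai aibi bi)); apply: ler_wpM2r; first exact: addr_ge0.
  by rewrite (le_trans (ler_norm M))// lerDl.
have -> : e = (`|M| + 1) * (e' + e') by rewrite /e'; field; rewrite gt_eqF.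
by rewrite ltr_pM2l// ltrD.
Qed.

Lemma abs_cont_on_lipschitz (V : normedModType R) (f : R -> V) (a b M : R) :
  (forall s t, a <= s -> s <= t -> t <= b -> `|f t - f s| <= M * (t - s)) ->
  abs_cont_on f a b.
Proof.
have ACid : abs_cont_on (idfun : R -> R) a b.
  move=> e e0; exists e => // n a_ b_ ab _; congr (_ < _); apply: eq_bigr => i _.
  by rewrite ger0_norm// subr_ge0; have [_ []] := ab i (ltn_ord i).
(* The identity plays both dominating functions, so each takes half of [M]. *)
move=> fM; apply: (abs_cont_on_dominated (M := M / 2) ACid ACid) => s t as_ st tb.
by rewrite /= ger0_norm ?subr_ge0//; have := fM s t as_ st tb; lra.
Qed.

Lemma abs_cont_on_uniform (V : normedModType R) (f : R -> V) (a b e : R) :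
  abs_cont_on f a b -> 0 < e -> exists2 d, 0 < d &
    forall s t, a <= s -> s <= t -> t <= b -> t - s < d -> `|f t - f s| < e.
Proof.
move=> ACf e0; have [d d0 fd] := ACf e e0; exists d => // s t as_ st tb tsd.
have := fd 1%N (fun=> s) (fun=> t); rewrite !big_ord_recl !big_ord0 !addr0.
by apply=> // i j; rewrite !ltnS !leqn0 => /eqP -> /eqP ->.
Qed.

Lemma abs_cont_on_bounded (V : normedModType R) (f : R -> V) (a b : R) :
  a <= b -> abs_cont_on f a b ->
  exists M, forall t, a <= t <= b -> `|f t| <= M.
Proof.
move=> ab ACf; have [d d0 fd] := abs_cont_on_uniform ACf (@ltr01 R).
apply: (@sup_induction (fun s => exists M, forall t, a <= t <= s -> `|f t| <= M) a b ab).
  by exists `|f a| => t /le_anti ->.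
(* A step from [t] to [s] spans up to twice the radius, and [2 * d / 3] is still below [d]. *)
move=> r /andP[ar rb]; exists (d / 3); first by rewrite divr_gt0.
move=> t s at_ rt tr rs sr sb [M fM]; exists (Num.max M (`|f t| + 1)) => w /andP[aw ws].
rewrite le_max; have [wt|tw] := leP w t; first by rewrite fM// aw.
apply/orP; right.
have : `|f w - f t| < 1.
  by apply: fd => //; [exact: ltW|exact: le_trans sb|lra].
have := lerB_dist (f w) (f t); lra.
Qed.

Lemma abs_cont_onM (f g : R -> R) (a b : R) : a <= b ->
  abs_cont_on f a b -> abs_cont_on g a b -> abs_cont_on (fun t => f t * g t) a b.
Proof.
move=> ab ACf ACg.
have [M fM] := abs_cont_on_bounded ab ACf; have [N gN] := abs_cont_on_bounded ab ACg.
apply: (abs_cont_on_dominated (M := M + N) ACf ACg) => s t as_ st tb.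
have -> : f t * g t - f s * g s = f t * (g t - g s) + g s * (f t - f s) by ring.
apply: (le_trans (ler_normD _ _)); rewrite !normrM.
have ft : `|f t| <= M by apply: fM; rewrite (le_trans as_).
have gs : `|g s| <= N by apply: gN; rewrite as_ (le_trans st).
have := ler_wpM2r (normr_ge0 (g t - g s)) ft.
have := ler_wpM2r (normr_ge0 (f t - f s)) gs.
have := mulr_ge0 (le_trans (normr_ge0 _) ft) (normr_ge0 (f t - f s)).
have := mulr_ge0 (le_trans (normr_ge0 _) gs) (normr_ge0 (g t - g s)).
nra.
Qed.

(** * Mean value theorem, Gronwall argument, divergent primitives *)

Lemma MVT_is_derive (f df : R -> R) (a b : R) : a <= b ->
  (forall t, a <= t <= b -> is_derive t 1 f (df t)) ->
  exists2 c, a <= c <= b & f b - f a = df c * (b - a).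
Proof.
move=> ab fdf; have [| |w] := @MVT_segment R f df a b ab.
- by move=> w; rewrite in_itv/= => /andP[aw wb]; apply: fdf; rewrite !ltW.
- apply: derivable_within_continuous => w; rewrite in_itv/= => wab.
  exact: (@ex_derive _ _ _ _ _ _ (df w)) (fdf _ wab).
- by rewrite in_itv/= => wab fE; exists w.
Qed.

Lemma is_derive_ge0_le (f df : R -> R) (a b : R) : a <= b ->
  (forall t, a <= t <= b -> is_derive t 1 f (df t)) ->
  (forall t, a <= t <= b -> 0 <= df t) -> f a <= f b.
Proof.
move=> ab fdf df0; have [c /df0 dfc] := MVT_is_derive ab fdf.
by have : 0 <= df c * (b - a); [rewrite mulr_ge0 ?subr_ge0|lra].
Qed.

Lemma abs_cont_on_derive_bounded (f df : R -> R) (a b M : R) :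
  (forall t, a <= t <= b -> is_derive t 1 f (df t)) ->
  (forall t, a <= t <= b -> `|df t| <= M) -> abs_cont_on f a b.
Proof.
move=> fdf dfM; apply: (abs_cont_on_lipschitz (M := M)) => s t as_ st tb.
have sub w : s <= w <= t -> a <= w <= b.
  by move=> /andP[sw wt]; rewrite (le_trans as_) ?(le_trans wt).
have [w wst ->] := MVT_is_derive st (fun w wst => fdf w (sub w wst)).
by rewrite normrM (@ger0_norm _ (t - s)) ?ler_wpM2r ?subr_ge0 ?dfM ?sub.
Qed.

(** With the integrating factor [K = exp (c * E)], the function [K * (theta - eta)] has an almost
    everywhere nonpositive derivative, hence is nonincreasing, while [K] tends to infinity. The
    bound [M] on [f] makes [K] Lipschitz on bounded intervals, hence absolutely continuous. *)
Lemma gronwall_ae (theta E f : R -> R) (c eta T M : R) : 0 < c ->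
  (forall t, T <= t -> is_derive t 1 E (f t)) ->
  (forall t, T <= t -> 0 <= f t <= M) ->
  E t @[t --> +oo] --> +oo ->
  (forall b, T <= b -> abs_cont_on theta T b) ->
  {ae mu, forall t, T <= t -> derivable theta t 1 /\
     derive1 theta t <= - (c * f t * (theta t - eta))} ->
  forall eta', eta < eta' -> \forall t \near +oo, theta t < eta'.
Proof.
move=> c0 dE fM Eoo ACtheta dtheta eta' etaeta'.
pose K t := expR (c * E t).
have dK t : T <= t -> is_derive t 1 K (c * f t * K t).
  move=> Tt.
  have cE : is_derive t 1 (c \*: E) (c * f t) by exact: is_deriveZ (dE _ Tt).
  apply: (is_derive_eq (is_derive1_comp (is_derive_expR _) cE)).
  by rewrite mulrC.
have E_nd s t : T <= s -> s <= t -> E s <= E t.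
  move=> Ts st; apply: (@is_derive_ge0_le E f) => // w /andP[sw _].
    by apply: dE; exact: le_trans sw.
  by have /andP[] := fM w (le_trans Ts sw).
have key b : T <= b -> K b * (theta b - eta) <= K T * (theta T - eta).
  move=> Tb.
  apply: (@abs_cont_ae_derive_le0 (fun t => K t * (theta t - eta)) T b Tb).
    apply: abs_cont_onM => //.
      apply: (@abs_cont_on_derive_bounded _ (fun t => c * f t * K t) _ _ (c * M * K b)).
        by move=> t /andP[Tt tb]; exact: dK.
      move=> t /andP[Tt tb]; have /andP[f0 fM'] := fM t Tt.
      rewrite ger0_norm; last by rewrite !mulr_ge0 ?expR_ge0// ltW.
      rewrite ler_pM ?expR_ge0 ?mulr_ge0 ?(ltW c0)// ?ler_wpM2l ?(ltW c0)//.
      by rewrite ler_expR ler_wpM2l ?(ltW c0)// E_nd.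
    apply: (abs_cont_on_dominated (M := 1) (ACtheta b Tb) (ACtheta b Tb)) => s t _ _ _.
    rewrite (_ : _ - _ - _ = theta t - theta s); last by ring.
    by rewrite mul1r lerDl.
  apply: (@filterS _ _ (ae_filter_ringOfSetsType mu) _ _ _ dtheta) => t Ht /andP[Tt tb].
  have [dth thle] := Ht Tt.
  have dth' : is_derive t 1 (theta - cst eta) (derive1 theta t).
    rewrite derive1E -[X in is_derive _ _ _ X]subr0.
    exact: is_deriveB (derivableP dth) (is_derive_cst _ _ _).
  have dg := is_deriveM (dK t Tt) dth'.
  have -> : (fun t => K t * (theta t - eta)) = K * (theta - cst eta) by [].
  split; first exact: ex_derive.
  rewrite derive1E derive_val /= -![_ *: _]/(_ * _).
  rewrite -[(theta - cst eta) t]/(theta t - eta).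
  have K0 : 0 < K t by exact: expR_gt0.
  nra.
near=> t.
have Tt : T <= t by near: t; apply: nbhs_pinfty_ge; rewrite num_real.
have K0 : 0 < K t by exact: expR_gt0.
have := key t Tt.
(* Follows from [1 + u <= exp u] at [u = c * E t], once [E t] is large. *)
have : `|K T * (theta T - eta)| < K t * (eta' - eta).
  rewrite -ltr_pdivrMr ?subr_gt0//.
  have : (`|K T * (theta T - eta)| / (eta' - eta)) / c < E t.
    by near: t; move/cvgryPgt: Eoo; exact.
  rewrite (ltr_pdivrMr _ _ c0) => /lt_trans; apply.
  rewrite mulrC; apply: lt_le_trans (expR_ge1Dx _).
  by rewrite ltrDr.
have := ler_norm (K T * (theta T - eta)).
rewrite -subr_lt0 -(pmulr_rlt0 _ K0); nra.
Unshelve. all: end_near. Qed.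

(* The integrand is extended to the negative axis as [f `|t|], so that E is
   differentiable at 0 as well. *)
Lemma divergent_antiderivative (f : R -> R) :
  (forall t : R, 0 <= t -> {for t, continuous f}) ->
  (forall t, 0 <= t -> 0 <= f t) ->
  (\int[mu]_(t in `[0%R, +oo[) (f t)%:E = +oo)%E ->
  exists2 E : R -> R, forall t : R, 0 <= t -> is_derive t 1 E (f t) &
    E t @[t --> +oo] --> +oo.
Proof.
move=> cf f0 foo.
have cfn : continuous (fun t : R => f `|t|).
  move=> t; apply: (continuous_comp (g := f)); last exact: cf.
  exact: norm_continuous.
(* Starting the integral at -1 makes 0 an interior point. *)
pose E t := (\int[mu]_(s in `[(-1), t]) f `|s : R|)%R.
have dE (t : R) : 0 <= t -> is_derive t 1 E (f t).
  move=> t0.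
  have [] := @continuous_FTC1_closed R (fun t : R => f `|t|) (-1) t (t + 1).
  - by rewrite ltrDl.
  - apply: continuous_compact_integrable; first exact: segment_compact.
    exact: continuous_subspaceT.
  - by lra.
  - exact: cfn.
  by move=> dEt; rewrite derive1E ger0_norm.
exists E => //.
have E_nd (s t : R) : 0 <= s -> s <= t -> E s <= E t.
  move=> s0 st; apply: (@is_derive_ge0_le E f) => // w /andP[sw _].
    by apply: dE; exact: le_trans sw.
  by apply: f0; exact: le_trans sw.
(* As [E] is nondecreasing it suffices that it be unbounded; a bounded [E] would converge and give
   the integral of [f] a finite value. *)
suff unb A : exists2 t, 0 <= t & A <= E t.
  apply/cvgryPge => A; have [t t0 At] := unb A.
  near=> s; apply: (le_trans At); apply: E_nd => //.
apply: contrapT => bounded.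
have EA t : 0 <= t -> E t <= A.
  by move=> t0; rewrite leNgt; apply/negP => /ltW ?; apply: bounded; exists t.
have [l El] : exists l : R, E t @[t --> +oo] --> l.
  (* [E] is known to be monotone only on the nonnegative axis; composing with [Num.max 0] makes it
     so everywhere. *)
  exists (sup (range (E \o Num.max 0))).
  have : (E \o Num.max 0) t @[t --> +oo] --> sup (range (E \o Num.max 0)).
    apply: nondecreasing_cvgr.
      move=> s t st; apply: E_nd; first by rewrite le_max lexx.
      by rewrite ge_max le_max lexx/= le_max st orbT.
    by exists A => _ [t _ <-]; apply: EA; rewrite le_max lexx.
  apply: cvg_trans; apply: near_eq_cvg; near=> t; rewrite /= max_r//.
have : (\int[mu]_(t in `[0%R, +oo[) (f t)%:E = l%:E - (E 0)%:E)%E.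
  apply: ge0_continuous_FTC2y => //.
  - by apply: continuous_in_subspaceT => t; rewrite inE/= in_itv/= andbT; exact: cf.
  - by move=> t /ltW t0; apply: (@ex_derive _ _ _ _ _ _ (f t)); exact: dE.
  - apply: cvg_at_right_filter; apply: differentiable_continuous.
    by apply/derivable1_diffP; apply: (@ex_derive _ _ _ _ _ _ (f 0)); exact: dE.
  - move=> t; rewrite in_itv/= andbT => /ltW t0.
    by rewrite derive1E; apply: (@derive_val _ _ _ _ _ _ _ (dE t t0)).
by rewrite foo.
Unshelve. all: end_near. Qed.

End AbsoluteContinuity.

(** * Inner product calculus *)

Section Hilbert.
Variables (R : realType) (V : normedModType R) (ip : V -> V -> R).
Hypothesis ipP : is_inner_product ip.
Implicit Types (x y z : V) (a : R).

Lemma ipC x y : ip x y = ip y x.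
Proof. by have [] := ipP. Qed.

Lemma ipDl x y z : ip (x + y) z = ip x z + ip y z.
Proof. by have [_ [h _]] := ipP; rewrite -[x]scale1r h mul1r scale1r. Qed.

Lemma ip0l z : ip 0 z = 0.
Proof. by have := ipDl 0 0 z; rewrite addr0; lra. Qed.

Lemma ipZl a x z : ip (a *: x) z = a * ip x z.
Proof. by have [_ [h _]] := ipP; rewrite -[a *: x]addr0 h ip0l addr0. Qed.

Lemma ipNl x z : ip (- x) z = - ip x z.
Proof. by rewrite -scaleN1r ipZl mulN1r. Qed.

Lemma ipDr x y z : ip z (x + y) = ip z x + ip z y.
Proof. by rewrite !(ipC z) ipDl. Qed.

Lemma ipZr a x z : ip z (a *: x) = a * ip z x.
Proof. by rewrite !(ipC z) ipZl. Qed.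

Lemma ipNr x z : ip z (- x) = - ip z x.
Proof. by rewrite !(ipC z) ipNl. Qed.

Lemma ipxx x : ip x x = `|x| ^+ 2.
Proof. by have [_ []] := ipP. Qed.

Definition ipE := (ipDl, ipDr, ipNl, ipNr, ipZl, ipZr).

Lemma ip_polar x y : ip x y = 4^-1 * (`|x + y| ^+ 2 - `|x - y| ^+ 2).
Proof. by rewrite -!ipxx !ipE (ipC y x); field. Qed.

Lemma parallelogram x y :
  `|2^-1 *: (x + y)| ^+ 2
  = 2^-1 * `|x| ^+ 2 + 2^-1 * `|y| ^+ 2 - 4^-1 * `|x - y| ^+ 2.
Proof. by rewrite -!ipxx !ipE (ipC y x); field. Qed.

(** Polarization reduces this to the continuity of the norm. *)
Lemma cvg_ip (T : Type) (F : set_system T) (FF : Filter F) (f g : T -> V) x y :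
  f @ F --> x -> g @ F --> y -> ip (f t) (g t) @[t --> F] --> ip x y.
Proof.
move=> fx gy; rewrite ip_polar.
under eq_fun do rewrite ip_polar.
apply: cvgZr; apply: cvgB.
  under eq_fun do rewrite expr2.
  by rewrite expr2; apply: cvgM; apply: cvg_norm; apply: cvgD.
under eq_fun do rewrite expr2.
by rewrite expr2; apply: cvgM; apply: cvg_norm; apply: cvgB.
Qed.

(** The difference quotient is exactly the inner product of the quotient of [f] with the mean of
    [f (h + t)] and [f t]. *)
Lemma is_derive_half_sqr_norm (f : R -> V) (t : R) (df : V) : is_derive t (1 : R) f df ->
  is_derive t (1 : R) (fun s : R => 2^-1 * `|f s| ^+ 2) (ip df (f t)).
Proof.
move=> fdf.
have cf : f (h + t) @[h --> 0^'] --> f t.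
  have : {for t, continuous f}.
    by apply: differentiable_continuous; apply/derivable1_diffP; exact: ex_derive.
  rewrite continuous_shift => c0.
  have {}c0 : f (h + t) @[h --> (0 : R)] --> f (0 + t) by exact: c0.
  by rewrite add0r in c0; exact: cvg_within_filter.
have qf : h^-1 *: ((f \o shift t) (h *: 1) - f t) @[h --> 0^'] --> df.
  by rewrite -[df](@derive_val _ _ _ _ _ _ _ fdf); apply: (@ex_derive _ _ _ _ _ _ df).
have : h^-1 *: (((fun s => 2^-1 * `|f s| ^+ 2) \o shift t) (h *: 1) - 2^-1 * `|f t| ^+ 2)
    @[h --> 0^'] --> ip df (f t).
  have -> : ip df (f t) = ip df (2^-1 *: (f t + f t)).
    by rewrite !ipE; field.
  have sf : 2^-1 *: (f (h + t) + f t) @[h --> 0^'] --> 2^-1 *: (f t + f t).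
    by apply: cvgZr; apply: cvgD => //; exact: cvg_cst.
  apply: cvg_trans (cvg_ip _ qf sf).
  apply: near_eq_cvg; near=> h.
  by rewrite /= -!ipxx !ipE (ipC (f t)) -[h *: 1]/(h * 1) mulr1 -[_ *: _]/(_ * _); ring.
move=> cq; apply: DeriveDef; first by apply/cvg_ex; exists (ip df (f t)).
exact: cvg_lim cq.
Unshelve. all: end_near. Qed.

End Hilbert.

(** * Gradients of convex functions *)

Section Convex.
Variables (R : realType) (V : normedModType R).
Implicit Types (f : V -> R) (x h : V).

Lemma diff_right_quotient f x h : differentiable f x ->
  k^-1 * (f (x + k *: h) - f x) @[k --> 0^'+] --> 'd f x h.
Proof.
move=> df; apply: cvg_dnbhs_at_right; rewrite -deriveE//.
have : k^-1 *: ((f \o shift x) (k *: h) - f x) @[k --> 0^'] --> 'D_h f x.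
  exact: diff_derivable df.
apply: cvg_trans; apply: near_eq_cvg; near=> k.
by rewrite /= [k *: h + x]addrC.
Unshelve. all: end_near. Qed.

(** Convexity on the segment bounds every quotient with step in ]0, 1] by the full increment; the
    step then tends to 0. *)
Lemma convex_gradient_ineq f x h : convex_fun f -> differentiable f x ->
  'd f x h <= f (x + h) - f x.
Proof.
move=> cf df; apply: cvgr_to_le (diff_right_quotient (h := h) df) _; near=> k.
have k0 : 0 < k by near: k; exact: nbhs_right_gt.
have k1 : k <= 1 by near: k; exact: nbhs_right_le.
rewrite ler_pdivrMl//.
have := cf x (x + h) k (ltW k0) k1.
by rewrite scalerBl scale1r scalerDr addrA subrK; lra.
Unshelve. all: end_near. Qed.

Lemma diff_ge0_minimum f x h : (forall z, f x <= f z) -> differentiable f x ->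
  0 <= 'd f x h.
Proof.
move=> fx df; apply: cvgr_to_ge (diff_right_quotient (h := h) df) _; near=> k.
have k0 : 0 < k by near: k; exact: nbhs_right_gt.
by rewrite mulr_ge0 ?invr_ge0 ?(ltW k0)// subr_ge0.
Unshelve. all: end_near. Qed.

End Convex.

(** * The zero of minimal norm and the viscosity bound *)

(* The minimal norm zero is the limit of near-minimizers [z n] of
   [2 (n + 1) Phi + |.|^2], which the parallelogram law makes Cauchy. *)
Lemma min_norm_zero (R : realType) (H : completeNormedModType R)
    (ip : H -> H -> R) (Phi : H -> R) :
  is_inner_product ip -> (forall z, 0 <= Phi z) -> convex_fun Phi ->
  continuous Phi -> (exists z, Phi z = 0) ->
  exists p, [/\ Phi p = 0, forall c, Phi c = 0 -> `|p| <= `|c| &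
    forall eta, 0 < eta -> exists2 d, 0 < d & forall e z, 0 <= e <= d ->
      e * (`|p| ^+ 2 - eta) <= 2 * Phi z + e * `|z| ^+ 2].
Proof.
move=> ipP Phi0 cvxPhi ctPhi [c0 Phic0].
pose J (n : nat) (z : H) : R := 2 * n.+1%:R * Phi z + `|z| ^+ 2.
have J0 n z : 0 <= J n z by rewrite addr_ge0 ?mulr_ge0.
have infJ n : has_inf (range (J n)).
  by split; [exists (J n 0), 0|exists 0 => _ [z _ <-]].
pose m n := inf (range (J n)).
have mJ n z : m n <= J n z by apply: ge_inf; [case: (infJ n)|exists z].
have mC n c : Phi c = 0 -> m n <= `|c| ^+ 2.
  by move=> Pc; apply: (le_trans (mJ n c)); rewrite /J Pc mulr0 add0r.
have m_nd : {homo m : n k / (n <= k)%N >-> n <= k}.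
  move=> n k nk; apply: lb_le_inf; first by exists (J k 0), 0.
  move=> _ [z _ <-]; apply: (le_trans (mJ n z)).
  by rewrite /J lerD2r ler_wpM2r// ler_wpM2l// ler_nat ltnS.
pose l := sup (range m).
have um : has_ubound (range m) by exists (`|c0| ^+ 2) => _ [n _ <-]; exact: mC.
have ml : m n @[n --> \oo] --> l by exact: nondecreasing_cvgn.
have m_le n : m n <= l by apply: ub_le_sup => //; exists n.
have /choice[z zJ] n : exists z, J n z < m n + harmonic n.
  have [_ [z _ <-] Jz] := inf_adherent (harmonic_gt0 n) (infJ n).
  by exists z.
(* The midpoint of [z n] and [z k] is tested against [m n]; since [J n] is at most [J k], both
   points have [J n] value at most [l + harmonic n], and the parallelogram defect bounds their
   distance. *)
have z_dist n k : (n <= k)%N -> `|z n - z k| ^+ 2 <= 2 * (l - m n) + 4 * harmonic n.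
  move=> nk.
  have := mJ n (2^-1 *: (z n + z k)).
  rewrite {1}/J (parallelogram ipP).
  have : Phi (2^-1 *: (z n + z k)) <= 2^-1 * Phi (z n) + 2^-1 * Phi (z k).
    have := cvxPhi (z n) (z k) 2^-1; rewrite invr_ge0 invf_le1// ler1n ler0n.
    move=> /(_ isT isT); rewrite (_ : 1 - 2^-1 = 2^-1 :> R); last by field.
    by rewrite -scalerDr.
  have hk : harmonic k <= harmonic n :> R by rewrite /harmonic lef_pV2 ?posrE// ler_nat.
  have := zJ n; have := zJ k; rewrite {1 2}/J.
  have nk1 : (n.+1%:R : R) <= k.+1%:R by rewrite ler_nat.
  have := m_le k.
  move=> mk Jn Jk Pmid mmid.
  have := ler_wpM2l (ler0n R n.+1) Pmid; have := ler_wpM2r (Phi0 (z k)) nk1.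
  lra.
have u0 : 2 * (l - m n) + 4 * harmonic n @[n --> \oo] --> (0 : R).
  rewrite (_ : (0 : R) = 2 * (l - l) + 4 * 0); last by rewrite subrr !mulr0 addr0.
  apply: cvgD; apply: cvgMr; last exact: cvg_harmonic.
  by apply: cvgB => //; exact: cvg_cst.
have /cauchy_cvg : cauchy (z @ \oo).
  apply: cauchy_exP => e e0; have e20 : 0 < e ^+ 2 by rewrite exprn_gt0.
  have [N _ HN] : \forall n \near \oo, 2 * (l - m n) + 4 * harmonic n < e ^+ 2.
    exact: cvgr_lt u0 _ e20.
  exists (z N); exists N => // k Nk; rewrite -ball_normE /=.
  rewrite -(ltr_pXn2r (n := 2)) ?nnegrE ?(ltW e0)//.
  exact: le_lt_trans (z_dist _ _ Nk) (HN N (leqnn N)).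
set q := lim (z @ \oo) => zq.
have Phiq : Phi q = 0.
  apply: le_anti; rewrite Phi0 andbT.
  have Phiz : Phi (z n) @[n --> \oo] --> Phi q.
    by apply: continuous_cvg => //; exact: ctPhi.
  (* The penalty [2 * n.+1%:R * Phi (z n)] stays below [|c0|^2 + 1], so [Phi (z n)] is of order
     [harmonic n]. *)
  have b0 : (`|c0| ^+ 2 + 1) * harmonic n @[n --> \oo] --> (0 : R).
    by rewrite -[X in _ --> X](mulr0 (`|c0| ^+ 2 + 1)); apply: cvgMr; exact: cvg_harmonic.
  apply: ler_cvg_to Phiz b0 _; near=> n.
  have := zJ n; have := mC n _ Phic0.
  have := mulr_ge0 (Phi0 (z n)) (ler0n R n.+1); rewrite /J /harmonic /=.
  have n0 : 0 < n.+1%:R :> R by [].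
  have h1 : n.+1%:R^-1 <= 1 :> R by rewrite invf_le1// ler1n.
  rewrite ler_pdivlMr//.
  have := sqr_ge0 `|z n|; move: h1; clear.
  by move: (_^-1) => i; move: (n.+1%:R) => N; lra.
have qnorm : `|q| ^+ 2 <= l.
  have zn : `|z n| ^+ 2 @[n --> \oo] --> `|q| ^+ 2.
    under eq_fun do rewrite expr2.
    by rewrite expr2; apply: cvgM; apply: cvg_norm.
  have b0 : l + harmonic n @[n --> \oo] --> l.
    by rewrite -[X in _ --> X]addr0; apply: cvgD; [exact: cvg_cst|exact: cvg_harmonic].
  apply: ler_cvg_to zn b0 _; near=> n.
  have := zJ n; have := m_le n.
  have : 0 <= 2 * n.+1%:R * Phi (z n) by rewrite !mulr_ge0.
  by rewrite /J; lra.
exists q; split=> //.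
- move=> c Pc; rewrite -(ler_pXn2r (n := 2)) ?nnegrE//.
  apply: (le_trans qnorm); apply: ge_sup; first by exists (m 0%N), 0%N.
  by move=> _ [n _ <-]; exact: mC.
- move=> eta eta0.
  (* For [e <= 1 / (n + 1)], multiplying [|q|^2 - eta < m n <= J n w] by [e] leaves a coefficient at
     most 2 in front of [Phi w]. *)
  have [n ln] : exists n, l - eta < m n.
    have supm : has_sup (range m) by split=> //; exists (m 0%N), 0%N.
    by have [_ [n _ <-] ln] := sup_adherent eta0 supm; exists n.
  exists n.+1%:R^-1; first by rewrite invr_gt0.
  move=> e w /andP[e0 en].
  have := mJ n w; rewrite /J => Jw.
  have en1 : e * n.+1%:R <= 1 by rewrite -ler_pdivlMr// div1r.
  have := ler_wpM2r (Phi0 w) en1.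
  have : e * (`|q| ^+ 2 - eta) <= e * (2 * n.+1%:R * Phi w + `|w| ^+ 2).
    by rewrite ler_wpM2l//; lra.
  by rewrite mul1r; nra.
Unshelve. all: end_near. Qed.

(** * Lyapunov estimate and strong convergence *)

(* To be read with e = eps t, pp = |p|^2, aa = |x - p|^2, xx = |x|^2,
   vv = |v|^2, xv = <x, v>, va = <v, x - p> and th = |x - p + mu v|^2 / 2; the
   left-hand side is then the derivative of th along the system. *)
Lemma lyapunov_inequality (R : realFieldType)
    (mu e eta pp aa xx vv xv va Phix th : R) :
  0 < mu -> 0 <= e -> 0 <= aa -> mu * e <= 2^-1 -> mu * e * pp <= eta ->
  Phix <= va -> 0 <= vv + e * xv + 4^-1 * e ^+ 2 * xx ->
  xx <= 2 * aa + 2 * pp -> e * (pp - eta) <= 2 * Phix + e * xx ->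
  th <= 2 * aa ->
  - mu * (va + mu * vv + e * (2^-1 * (xx + aa - pp)) + e * mu * xv)
  <= - (mu / 8 * e * (th - 8 * eta)).
Proof.
move=> mu0 e0 aa0 mue muepp Pva sq xxle visc thle.
rewrite mulNr lerN2 -!mulrA ler_pM2l//.
(* The terms in [va], [xx], [aa] and [pp] give at least [e * (aa - eta) / 2]. The cross term costs
   [mu * e ^+ 2 * xx / 4], at most [e * aa / 4 + e * eta / 2] by [h2], [h3] and [h4]; what remains
   is [e * aa / 4 - e * eta]. *)
have h1 := mulr_ge0 (ltW mu0) sq.
have h2 : mu * e ^+ 2 * xx <= mu * e ^+ 2 * (2 * aa + 2 * pp).
  by rewrite ler_wpM2l// mulr_ge0 ?sqr_ge0// ltW.
have h3 := ler_wpM2r (mulr_ge0 e0 aa0) mue.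
have h4 := ler_wpM2l e0 muepp.
have h5 := ler_wpM2l e0 thle.
lra.
Qed.

Unset Implicit Arguments.
Set Strict Implicit.

Theorem theorem3p3 (R : realType) (H : completeNormedModType R)
  (ip : H -> H -> R) (lambda L : R) (Phi : H -> R) (gradPhi : H -> H)
  (eps : R -> R) (x v : R -> H) :
  is_inner_product ip ->
  0 < lambda ->
  (* Phi : H -> R^+ convex, differentiable with gradient gradPhi *)
  (forall z, 0 <= Phi z) ->
  convex_fun Phi ->
  (forall z, differentiable Phi z /\ forall h, 'd Phi z h = ip (gradPhi z) h) ->
  (* gradient L-Lipschitz, L > 0 *)
  0 < L ->
  (forall z w, `|gradPhi z - gradPhi w| <= L * `|z - w|) ->
  (* C = argmin Phi = Phi^-1(0) nonempty *)
  (exists z, Phi z = 0) ->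
  (* mu L < 1 with mu = 1/lambda *)
  lambda^-1 * L < 1 ->
  (* eps : [0,+oo[ -> [0,+oo[ *)
  (forall t, 0 <= t -> 0 <= eps t) ->
  (* (H1) *)
  (forall p, range_normal_cone ip [set z | Phi z = 0] p ->
     (\int[lebesgue_measure]_(t in `[0%R, +oo[)
        ((lambda^-1)%:E * fenchel ip Phi ((eps t / lambda^-1)%R *: p)
         - support_fun ip [set z | Phi z = 0%R] (eps t *: p)
         + (2^-1 * `|eps t *: p| ^+ 2)%R%:E) < +oo)%E) ->
  (* (H2) *)
  (forall s t, 0 <= s -> s <= t -> eps t <= eps s) ->
  (forall t, 0 <= t -> derivable eps t 1) ->
  (forall t, 0 <= t -> {for t, continuous ((derive1 eps))}) ->
  (exists K : R, forall s t, 0 <= s -> 0 <= t ->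
      `|eps s - eps t| <= K * `|s - t|) ->
  eps t @[t --> +oo] --> 0 ->
  (\int[lebesgue_measure]_(t in `[0%R, +oo[) (eps t)%:E = +oo)%E ->
  (exists2 k : R, 0 <= k & forall t, 0 <= t -> - k * eps t ^+ 2 <= (derive1 eps) t) ->
  (* (x, v) strong global solution *)
  (forall b, 0 <= b -> abs_cont_on x 0 b) ->
  (forall b, 0 <= b -> abs_cont_on v 0 b) ->
  (forall t, 0 <= t -> v t = gradPhi (x t)) ->
  {ae lebesgue_measure, forall t, 0 <= t ->
     [/\ derivable x t 1, derivable v t 1 &
         lambda *: derive1 x t + derive1 v t + v t + eps t *: x t = 0]} ->
  (* conclusion: x(t) and y(t) = x(t) + mu v(t) converge strongly to the
     element of minimal norm of C *)
  exists p : H,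
    [/\ Phi p = 0,
        (forall c, Phi c = 0 -> `|p| <= `|c|),
        x t @[t --> +oo] --> p &
        (x t + lambda^-1 *: v t) @[t --> +oo] --> p].
Proof.
move=> ipP l0 Phi0 cvxPhi dPhi L0 lipPhi exC muL eps0 _ _ deps _ _ eps_cvg0
  epsoo _ ACx ACv vE ode.
pose mu := lambda^-1.
have mu0 : 0 < mu by rewrite invr_gt0.
have [p [Pp pmin visc]] : exists p, [/\ Phi p = 0,
    forall c, Phi c = 0 -> `|p| <= `|c| &
    forall eta, 0 < eta -> exists2 d, 0 < d & forall e z, 0 <= e <= d ->
      e * (`|p| ^+ 2 - eta) <= 2 * Phi z + e * `|z| ^+ 2].
  apply: min_norm_zero ipP Phi0 cvxPhi _ exC => z.
  by apply: differentiable_continuous; have [] := dPhi z.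
have gradp : gradPhi p = 0.
  have [dp dpE] := dPhi p.
  have pmin' z : Phi p <= Phi z by rewrite Pp.
  (* In the direction of minus the gradient, the derivative is minus its squared norm. *)
  have := @diff_ge0_minimum R H Phi p (- gradPhi p) pmin' dp.
  rewrite dpE (ipNr ipP) (ipxx ipP) oppr_ge0 => h.
  by apply/eqP; rewrite -normr_eq0 -sqrf_eq0 eq_le h sqr_ge0.
have grad_ineq z : Phi z <= ip (gradPhi z) (z - p).
  have [dz dzE] := dPhi z.
  have := @convex_gradient_ineq R H Phi z (p - z) cvxPhi dz.
  by rewrite dzE subrKC Pp -opprB (ipNr ipP); lra.
pose y t := x t + mu *: v t.
pose theta t := 2^-1 * `|y t - p| ^+ 2.
have x_le_y t : 0 <= t -> `|x t - p| <= `|y t - p|.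
  move=> t0; rewrite -(ler_pXn2r (n := 2)) ?nnegrE//.
  (* The cross term [2 * mu * ip (v t) (x t - p)] is nonnegative by [grad_ineq]. *)
  rewrite /y addrAC -!(ipxx ipP) (_ : forall a b, ip (a + mu *: b) (a + mu *: b) =
    ip a a + (2 * mu * ip b a + mu ^+ 2 * ip b b)); last first.
    by move=> a b; rewrite !(ipE ipP) (ipC ipP a b); ring.
  rewrite lerDl addr_ge0 ?mulr_ge0 ?(ltW mu0) ?(ipxx ipP)//.
  by rewrite vE//; exact: le_trans (grad_ineq _).
have theta_small eta : 0 < eta -> \forall t \near +oo, theta t < eta.
  (* The Gronwall level is [8 * eta'], half of [eta]. *)
  move=> eta0; pose eta' := eta / 16.
  have eta'0 : 0 < eta' by rewrite divr_gt0.
  have [d d0 visc_d] := visc _ eta'0.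
  pose pp := `|p| ^+ 2.
  have pp1 : 0 < pp + 1 by rewrite ltr_wpDl ?sqr_ge0.
  (* The three bounds on [eps t] give the viscosity bound, [mu * eps t <= 1 / 2] and
     [mu * eps t * pp <= eta']; [pp + 1] avoids a zero denominator. *)
  pose del := Num.min d (Num.min (lambda / 2) (lambda * eta' / (pp + 1))).
  have del0 : 0 < del by rewrite !lt_min d0 !divr_gt0// mulr_gt0.
  have [T T0 eps_del] : exists2 T, 0 <= T & forall t, T <= t -> eps t <= del.
    have : \forall t \near +oo, eps t <= del by apply: cvgr_le eps_cvg0 _ del0.
    case=> T [_ HT]; exists (Num.max 0 (T + 1)); first by rewrite le_max lexx.
    move=> t; rewrite ge_max => /andP[_ Tt]; apply: HT; lra.
  have [E dE Eoo] : exists2 E : R -> R, forall t : R, 0 <= t -> is_derive t 1 E (eps t) &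
      E t @[t --> +oo] --> +oo.
    apply: divergent_antiderivative => // t t0.
    by apply: differentiable_continuous; apply/derivable1_diffP; exact: deps.
  have ACtheta b : 0 <= b -> abs_cont_on theta 0 b.
    move=> b0.
    have ACy : abs_cont_on y 0 b.
      apply: (abs_cont_on_dominated (M := 1 + mu) (ACx b b0) (ACv b b0)) => s t _ _ _.
      have -> : y t - y s = (x t - x s) + mu *: (v t - v s).
        by rewrite /y scalerBr opprD addrACA.
      apply: (le_trans (ler_normD _ _)); rewrite normrZ gtr0_norm//.
      by have := normr_ge0 (x t - x s); have := normr_ge0 (v t - v s); nra.
    have ACn : abs_cont_on (fun t => `|y t - p|) 0 b.
      apply: (abs_cont_on_dominated (M := 1) ACy ACy) => s t _ _ _.
      rewrite mul1r; apply: (le_trans (ler_dist_dist _ _)).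
      by rewrite opprB addrA subrK lerDl.
    have ACn2 := abs_cont_onM b0 ACn ACn.
    apply: (abs_cont_on_dominated (M := 1) ACn2 ACn2) => s t _ _ _.
    rewrite /theta !expr2 -mulrBr normrM ger0_norm// mul1r.
    by have := normr_ge0 (`|y t - p| * `|y t - p| - `|y s - p| * `|y s - p|); lra.
  apply: (@gronwall_ae R theta E eps (mu / 8) (8 * eta') T del) => //.
  - by rewrite divr_gt0.
  - by move=> t Tt; apply: dE; exact: le_trans Tt.
  - by move=> t Tt; rewrite eps_del// eps0// (le_trans T0).
  - by move=> b Tb; apply: abs_cont_onS (ACtheta b _) => //; exact: le_trans Tb.
  - apply: (@filterS _ _ (ae_filter_ringOfSetsType (@lebesgue_measure R)) _ _ _ ode) => t Ht Tt.
    have t0 := le_trans T0 Tt; have [dx dv eqn] := Ht t0.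
    have e0 := eps0 _ t0.
    have := eps_del t Tt; rewrite !le_min => /andP[ed /andP[el epp]].
    (* Multiplied by [lambda], the derivative of [y] is the combination of derivatives in the
       differential equation. *)
    have dy : is_derive t (1 : R) (fun s => y s - p) (- mu *: (v t + eps t *: x t)).
      have h := is_deriveB (is_deriveD (derivableP dx) (is_deriveZ mu (derivableP dv)))
        (is_derive_cst p t 1).
      apply: (is_derive_eq h); rewrite subr0 -!derive1E.
      apply: (scalerI (lt0r_neq0 l0)); rewrite scalerDr !scalerA mulrN divff ?lt0r_neq0//.
      rewrite scale1r scaleN1r; apply/eqP; rewrite -addr_eq0 -eqn; apply/eqP.
      by rewrite !addrA.
    have dth := is_derive_half_sqr_norm ipP dy.
    split; first exact: (@ex_derive _ _ _ _ _ _ _ dth).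
    rewrite derive1E (@derive_val _ _ _ _ _ _ _ dth).
    have [a aE] : exists a, x t - p = a by exists (x t - p).
    have xE : x t = a + p by rewrite -aE subrK.
    have -> : y t - p = a + mu *: v t by rewrite /y addrAC aE.
    (* Uses [2 <x, x - p> = |x|^2 + |x - p|^2 - |p|^2]. *)
    have -> : ip (- mu *: (v t + eps t *: x t)) (a + mu *: v t) =
        - mu * (ip (v t) a + mu * ip (v t) (v t)
          + eps t * (2^-1 * (ip (x t) (x t) + ip a a - pp)) + eps t * mu * ip (x t) (v t)).
      by rewrite xE /pp -(ipxx ipP) !(ipE ipP) (ipC ipP p a); field.
    apply: (@lyapunov_inequality _ mu (eps t) eta' pp (ip a a) (ip (x t) (x t))
      (ip (v t) (v t)) (ip (x t) (v t)) (ip (v t) a) (Phi (x t))) => //.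
    + by rewrite (ipxx ipP) sqr_ge0.
    + by rewrite /mu mulrC ler_pdivrMr// mulrC.
    + move: epp; rewrite ler_pdivlMr// => /(ler_wpM2l (ltW mu0)).
      rewrite mulrA [_ * (lambda * _)]mulrA mulVf ?lt0r_neq0// mul1r.
      by have := mulr_ge0 (ltW mu0) e0; lra.
    + by rewrite vE//; rewrite -aE; exact: grad_ineq.
    (* Completing the square absorbs the cross term. *)
    + have := sqr_ge0 `|v t + (2^-1 * eps t) *: x t|.
      by rewrite -(ipxx ipP) !(ipE ipP) (ipC ipP (v t) (x t)); lra.
    + have := sqr_ge0 `|a - p|.
      by rewrite -(ipxx ipP) /pp -(ipxx ipP) xE !(ipE ipP) (ipC ipP p a); lra.
    + have := visc_d (eps t) (x t); rewrite e0 ed => /(_ isT).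
      by rewrite (ipxx ipP).
    + rewrite /theta /y addrAC aE (ipxx ipP).
      (* The gradient vanishes at [p], so [|mu v| <= mu L |a| <= |a|]. *)
      have : `|a + mu *: v t| <= 2 * `|a|.
        apply: (le_trans (ler_normD _ _)); rewrite normrZ gtr0_norm//.
        have := lipPhi (x t) p; rewrite gradp subr0 -vE// aE => va.
        have := ler_wpM2l (ltW mu0) va; have := ler_wpM2r (normr_ge0 a) (ltW muL).
        rewrite -/mu; lra.
      by move=> h; have := ler_pM (normr_ge0 _) (normr_ge0 _) h h; lra.
  - rewrite /eta'; lra.
have y_cvg : y t @[t --> +oo] --> p.
  apply/cvgrPdist_lt => e e0.
  have : 0 < 2^-1 * e ^+ 2 by rewrite mulr_gt0 ?exprn_gt0.
  move=> /theta_small; apply: filterS => t.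
  rewrite /theta ltr_pM2l// distrC.
  by rewrite ltr_pXn2r ?nnegrE ?(ltW e0).
exists p; split=> //.
apply/cvgrPdist_lt => e e0; move/cvgrPdist_lt : y_cvg => /(_ e e0) ye.
near=> t; rewrite distrC; apply: (@le_lt_trans _ _ `|y t - p|).
  by apply: x_le_y; near: t; apply: nbhs_pinfty_ge; rewrite num_real.
by rewrite distrC; near: t.
Unshelve. all: end_near. Qed.
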